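(* For every positive integer $n$ and all integers $m$, $p$, $q$: \[ \sum_{j = 0}^n \sum_{k = 0}^j \binom{n}{j}\binom{j}{k}P_{p - 4}^k P_{p - 3}^{j - k} P_{p - 5}^{n - j} P_{mn + q + k + j} = P_{(m + p)n + q}, \] \[ \sum_{j = 0}^n \sum_{k = 0}^j \binom{n}{j}\binom{j}{k}P_{m - 4}^k P_{m - 3}^{j - k} P_{m - 5}^{n - j} P_{pn + q + k + j} = P_{(m + p)n + q}, \] \[ \sum_{j = 0}^n \sum_{k = 0}^j \binom{n}{j}\binom{j}{k}P_{p - 4}^k P_{p - 3}^{j - k} P_{p - 5}^{n - j} Q_{mn + q + k + j} = Q_{(m + p)n + q}, \] \[ \sum_{j = 0}^n \sum_{k = 0}^j \binom{n}{j}\binom{j}{k}P_{m - 4}^k P_{m - 3}^{j - k} P_{m - 5}^{n - j} Q_{pn + q + k + j} = Q_{(m + p)n + q}. \]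
   Context: The Padovan numbers $P_n$ are defined for all integers $n$ by $P_0=P_1=P_2=1$ and $P_n=P_{n-2}+P_{n-3}$ for all integers $n$ (extended to negative indices via $P_n=P_{n+3}-P_{n+1}$). The Perrin numbers $Q_n$ are defined for all integers $n$ by $Q_0=3$, $Q_1=0$, $Q_2=2$ and $Q_n=Q_{n-2}+Q_{n-3}$ for all integers $n$. *)

(* Defs.v *)
From mathcomp Require Import all_boot all_order all_algebra.

Set Implicit Arguments.
Unset Strict Implicit.
Unset Printing Implicit Defensive.

Import GRing.Theory.
Local Open Scope ring_scope.

(* A bi-infinite sequence with u_n = u_(n-2) + u_(n-3) is computed by sliding
   the window (u_z, u_(z+1), u_(z+2)) forwards or backwards from z = 0; the
   backward step is u_z = u_(z+3) - u_(z+1). *)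
Definition window_next (w : int * int * int) : int * int * int :=
  let: (a, b, c) := w in (b, c, a + b).

Definition window_prev (w : int * int * int) : int * int * int :=
  let: (a, b, c) := w in (c - a, a, b).

Definition window (w0 : int * int * int) (z : int) : int * int * int :=
  match z with
  | Posz n => iter n window_next w0
  | Negz n => iter n.+1 window_prev w0
  end.

Definition padovan (z : int) : int := (window (1, 1, 1) z).1.1.

Definition perrin (z : int) : int := (window (3, 0, 2) z).1.1.

Lemma window_prevK : cancel window_prev window_next.
Proof. by case=> [[a b] c]; rewrite /= subrK. Qed.

Lemma windowS w0 z : window w0 (z + 1) = window_next (window w0 z).
Proof.
case: z => [n | [|n]]; first by rewrite -PoszD addn1.
  by rewrite [window _ (Negz 0)]/= window_prevK.
have -> : Negz n.+1 + 1 = Negz n.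
  by rewrite !NegzE -[n.+2]addn1 PoszD opprD subrK.
by rewrite /window [iter n.+2 _ _]iterS window_prevK.
Qed.

Lemma window_rec w0 z :
  (window w0 z).1.1 = (window w0 (z - 2)).1.1 + (window w0 (z - 3)).1.1.
Proof.
have -> : z - 2 = z - 3 + 1 by rewrite -addrA.
rewrite -[in LHS](subrK 3 z) (_ : z - 3 + 3 = z - 3 + 1 + 1 + 1); last first.
  by rewrite -!addrA.
by rewrite !windowS; case: (window _ _) => [[a b] c]; rewrite /= addrC.
Qed.

Lemma padovan_init : [/\ padovan 0 = 1, padovan 1 = 1 & padovan 2 = 1].
Proof. by []. Qed.

Lemma padovan_rec z : padovan z = padovan (z - 2) + padovan (z - 3).
Proof. exact: window_rec. Qed.

Lemma perrin_init : [/\ perrin 0 = 3, perrin 1 = 0 & perrin 2 = 2].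
Proof. by []. Qed.

Lemma perrin_rec z : perrin z = perrin (z - 2) + perrin (z - 3).
Proof. exact: window_rec. Qed.

(* Main.v *)
(* Every solution u of the Padovan recurrence satisfies
   u_(s+p) = P_(p-5) u_s + P_(p-3) u_(s+1) + P_(p-4) u_(s+2). Writing E for the
   shift operator on solutions, this reads E^p = P_(p-5) + E (P_(p-3) + P_(p-4) E).
   The sums of the theorem are obtained by expanding the n-th power of the right
   hand side with the binomial theorem twice. *)
Require Import Defs.
From mathcomp Require Import all_boot all_order all_algebra.
From mathcomp Require Import ring.

Import GRing.Theory.
Local Open Scope ring_scope.

Definition padovan_like (u : int -> int) :=
  forall z, u z = u (z - 2) + u (z - 3).

Lemma padovan_like_up u : padovan_like u ->
  forall z, u (z + 3) = u (z + 1) + u z.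
Proof. by move=> u_rec z; rewrite u_rec addrK -addrA. Qed.

(** Three consecutive values determine a solution in both directions, so the induction over the
    integers carries equality on a whole window [z], [z + 1], [z + 2]. *)
Lemma padovan_like_eq u v : padovan_like u -> padovan_like v ->
  u 0 = v 0 -> u 1 = v 1 -> u 2 = v 2 -> u =1 v.
Proof.
move=> /padovan_like_up u_up /padovan_like_up v_up e0 e1 e2 z.
suff [] : [/\ u z = v z, u (z + 1) = v (z + 1) & u (z + 2) = v (z + 2)] by [].
elim/int_ind: z => [|n [E0 E1 E2]|n [E0 E1 E2]]; first by rewrite !add0r.
- have -> : n.+1%:Z = n%:Z + 1 by rewrite intS addrC.
  by rewrite -!addrA E1 E2 u_up v_up E0 E1.
- have D : - n.+1%:Z = - n%:Z - 1 by rewrite intS opprD addrC.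
  have D1 : - n.+1%:Z + 1 = - n%:Z by rewrite D subrK.
  have D2 : - n.+1%:Z + 2 = - n%:Z + 1 by rewrite D -!addrA.
  have D3 : - n.+1%:Z + 3 = - n%:Z + 2 by rewrite D -!addrA.
  split; rewrite ?D1 ?D2 //.
  (* Backward step: adding the known value at [z + 1] turns the unknown value at [z] into the known
     one at [z + 3]. *)
  by apply: (addrI (u (- n.+1%:Z + 1))); rewrite -u_up D3 E2 -D3 v_up D1 E0.
Qed.

(** For fixed [s], both sides are solutions in [p], so it suffices to compare them at [p] = 0, 1,
    2. *)
Lemma padovan_like_shift u : padovan_like u -> forall s p,
  u (s + p) = padovan (p - 5) * u s + padovan (p - 3) * u (s + 1)
              + padovan (p - 4) * u (s + 2).
Proof.
move=> u_rec s p; move: p.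
apply: padovan_like_eq => [z|z|||].
- by rewrite u_rec !addrA.
- rewrite (padovan_rec (z - 5)) (padovan_rec (z - 3)) (padovan_rec (z - 4)).
  rewrite !(addrAC z (- 5)) (addrAC z (- 3) (- 2)) !(addrAC z (- 4)).
  ring.
(* At [p] = 0, 1, 2 the three Padovan coefficients evaluate to the unit vectors, by computing
   P_(-5), ..., P_(-1) = 1, 0, 0, 1, 0. *)
- by rewrite addr0; transitivity (1 * u s + 0 * u (s + 1) + 0 * u (s + 2)); [ring|].
- by transitivity (0 * u s + 1 * u (s + 1) + 0 * u (s + 2)); [ring|].
- by transitivity (0 * u s + 0 * u (s + 1) + 1 * u (s + 2)); [ring|].
Qed.

(* The shift operator in the coordinates (u_s, u_(s+1), u_(s+2)). *)
Definition shift_mx : 'M[int]_3 :=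
  \matrix_(i, j) nth 0 (nth [::] [:: [:: 0; 1; 0]; [:: 0; 0; 1]; [:: 1; 1; 0]] i) j.

Definition window_col (u : int -> int) (s : int) : 'cV[int]_3 :=
  \col_i u (s + (i : nat)%:Z).

(** The first two rows of [shift_mx] move the window along; the last one is the recurrence. *)
Lemma shift_mxX u : padovan_like u -> forall i s,
  shift_mx ^+ i *m window_col u s = window_col u (s + i%:Z).
Proof.
move=> /padovan_like_up u_up; elim=> [|i IHi] s.
  by rewrite expr0 mul1mx addr0.
have -> : s + i.+1%:Z = s + 1 + i%:Z by rewrite intS addrA.
rewrite exprSr -mulmxA -IHi; congr (_ *m _); apply/colP => j.
rewrite !mxE !big_ord_recl big_ord0 !mxE /= -addrA.
case: j => [[|[|[|//]]] lt_j3] /=; rewrite ?mul0r ?mul1r ?add0r ?addr0 //.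
by rewrite u_up addrC.
Qed.

Lemma padovan_like_sum u (n : nat) (m p q : int) : padovan_like u ->
  \sum_(0 <= j < n.+1) \sum_(0 <= k < j.+1)
    'C(n, j)%:Z * 'C(j, k)%:Z * padovan (p - 4) ^+ k
    * padovan (p - 3) ^+ (j - k) * padovan (p - 5) ^+ (n - j)
    * u (m * n%:Z + q + k%:Z + j%:Z)
  = u ((m + p) * n%:Z + q).
Proof.
move=> u_rec; set a := padovan (p - 5); set b := padovan (p - 3).
set c := padovan (p - 4); set s := m * n%:Z + q.
have -> : (m + p) * n%:Z + q = s + p * n%:Z by rewrite /s; ring.
(* [A] is E^p written as a polynomial in the matrix of E; the top entry of [A ^+ n] applied to the
   window at [s] is then the right-hand side. *)
pose A : 'M[int]_3 := a%:M + shift_mx * (b%:M + c *: shift_mx).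
have A_shift t : A *m window_col u t = window_col u (t + p).
  have shiftE v : shift_mx *m window_col u v = window_col u (v + 1).
    exact: (shift_mxX _ u_rec 1).
  rewrite /A mulmxDl mul_scalar_mx -mulmxE -mulmxA mulmxDl mul_scalar_mx.
  rewrite -scalemxAl mulmxDr -!scalemxAr !shiftE.
  apply/colP => i; rewrite !mxE [t + p + _]addrAC [RHS]padovan_like_shift //.
  have -> : t + 1 + i%:Z = t + i%:Z + 1 by ring.
  have -> : t + 1 + 1 + i%:Z = t + i%:Z + 2 by ring.
  by rewrite addrA.
have AX_shift t : A ^+ n *m window_col u t = window_col u (t + p * n%:Z).
  elim: n {s} t => [|n IHn] t; first by rewrite mul1mx mulr0 addr0.
  by rewrite exprSr -mulmxA A_shift IHn intS mulrDr mulr1 addrA.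
have -> : u (s + p * n%:Z) = (A ^+ n *m window_col u s) 0 0.
  by rewrite AX_shift mxE addr0.
rewrite {A_shift AX_shift}/A; clearbody a b c s.
(* Matrices do not commute in general, so each expansion needs its own commutation proof. Here [j]
   counts the factors E (b + c E). *)
rewrite big_mkord exprDn_comm; last exact: comm_scalar_mx.
rewrite mulmx_suml summxE; apply: eq_bigr => j _.
rewrite exprMn_comm; last first.
  by apply: commrD; [exact: comm_mx_scalar | rewrite /GRing.comm -scalerAl -scalerAr].
(* The index [k] counts the factors c E, so the total power of E is [j + k]. *)
rewrite big_mkord exprDn_comm; last exact: comm_scalar_mx.
rewrite !mulr_sumr -sumrMnl mulmx_suml summxE; apply: eq_bigr => k _.
rewrite exprZn -!(rmorphXn (@scalar_mx int 3)) /= !mulrnAr -mulrnA.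
rewrite -!mulmxE !mul_scalar_mx -!scalemxAr !scalerA mulmxE -exprD.
rewrite -scaler_nat scalerA -scalemxAl shift_mxX // !mxE addr0.
have -> : s + k%:Z + j%:Z = s + (j + k)%N%:Z by rewrite PoszD; ring.
rewrite natrM -!natz; ring.
Qed.

Theorem theorem17 (n : nat) (m p q : int) (n_gt0 : (0 < n)%N) :
  [/\ \sum_(0 <= j < n.+1) \sum_(0 <= k < j.+1)
        'C(n, j)%:Z * 'C(j, k)%:Z * padovan (p - 4) ^+ k
        * padovan (p - 3) ^+ (j - k) * padovan (p - 5) ^+ (n - j)
        * padovan (m * n%:Z + q + k%:Z + j%:Z)
      = padovan ((m + p) * n%:Z + q),
      \sum_(0 <= j < n.+1) \sum_(0 <= k < j.+1)
        'C(n, j)%:Z * 'C(j, k)%:Z * padovan (m - 4) ^+ k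
        * padovan (m - 3) ^+ (j - k) * padovan (m - 5) ^+ (n - j)
        * padovan (p * n%:Z + q + k%:Z + j%:Z)
      = padovan ((m + p) * n%:Z + q),
      \sum_(0 <= j < n.+1) \sum_(0 <= k < j.+1)
        'C(n, j)%:Z * 'C(j, k)%:Z * padovan (p - 4) ^+ k
        * padovan (p - 3) ^+ (j - k) * padovan (p - 5) ^+ (n - j)
        * perrin (m * n%:Z + q + k%:Z + j%:Z)
      = perrin ((m + p) * n%:Z + q)
    & \sum_(0 <= j < n.+1) \sum_(0 <= k < j.+1)
        'C(n, j)%:Z * 'C(j, k)%:Z * padovan (m - 4) ^+ k
        * padovan (m - 3) ^+ (j - k) * padovan (m - 5) ^+ (n - j)
        * perrin (p * n%:Z + q + k%:Z + j%:Z)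
      = perrin ((m + p) * n%:Z + q)].

Proof.
have P_rec : padovan_like padovan := padovan_rec.
have Q_rec : padovan_like perrin := perrin_rec.
(* The second and fourth identities are the first and third with [m] and [p] exchanged. *)
by split; rewrite ?[m + p]addrC padovan_like_sum // addrC.
Qed.
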